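(* Let $p\in(0,1)$, let $\mu$ be the $p$-biased measure on $\{-1,1\}^n$, and let $f:\{-1,1\}^n\to\mathbb{R}$. Let $\rho$ be any one of the three functions (i), (ii), (iii) listed in the context. Then for all $0\le\delta\le 1$, $$\lVert T_{\rho_1(\delta)\,\delta}f\rVert_2\le\lVert f\rVert_{1+\delta^2},\qquad\text{where }\rho_1(\delta)=\rho\left(\frac{1}{\delta^2}+1\right),$$ and where $\rho_1(\delta)\,\delta$ is read as $0$ when $\delta=0$.
   Context: The $p$-biased measure on $\{-1,1\}^n$ is the product probability measure under which each coordinate independently equals $1$ with probability $p$ and $-1$ with probability $1-p$. Norms are with respect to $\mu$: $\lVert f\rVert_q^q=\int|f|^q\,d\mu$. Let $\chi_i(x)=-\sqrt{p/(1-p)}$ if $x_i=-1$ and $\chi_i(x)=\sqrt{(1-p)/p}$ if $x_i=1$, and for $S\subseteq[n]=\{1,\dots,n\}$ let $\chi_S=\prod_{i\in S}\chi_i$ ($\chi_\emptyset=1$). These form an orthonormal basis of $L^2(\mu)$, and $f=\sum_{S\subseteq[n]}\hat f(S)\chi_S$ with $\hat f(S)=\int f\chi_S\,d\mu$. The smoothing operator is $T_\delta f=\sum_{S\subseteq[n]}\delta^{|S|}\hat f(S)\chi_S$, with $0^0=1$. Let $\lambda=\min\{p,1-p\}$. The three admissible functions $\rho$, defined for $q\ge 2$, are: (i) $\rho(q)=\lambda^{\frac12-\frac1q}$; (ii) $\rho(q)=\sqrt{q-1}\,\sqrt{\dfrac{\sinh\left(-\frac1q\ln\frac{\lambda}{1-\lambda}\right)}{\sinh\left(-\left(1-\frac1q\right)\ln\frac{\lambda}{1-\lambda}\right)}}$,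 understood as its limiting value $1$ when $\lambda=\frac12$; (iii) $\rho(q)=\sqrt{\dfrac{\lambda}{1-\lambda}}$ (constant in $q$). *)

(* Defs.v *)
(* MathComp / MathComp-Analysis, over an arbitrary R : realType. *)
From mathcomp Require Import all_boot all_order all_algebra.
From mathcomp Require Import reals sequences exp bernoulli_distribution.

Set Implicit Arguments.
Unset Strict Implicit.
Unset Printing Implicit Defensive.

Import Order.TTheory GRing.Theory Num.Theory.
Local Open Scope ring_scope.

(* The hypercube {-1,1}^n: [true] stands for 1 and [false] for -1. *)
Definition cube (n : nat) := {ffun 'I_n -> bool}.

Section BiasedCube.
Variables (R : realType) (n : nat) (p : R).
Implicit Types (x : cube n) (f g : cube n -> R) (S : {set 'I_n}).

(* Mass of a point under the product measure; [bernoulli_pmf p b] is p if b,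
   and 1 - p otherwise. *)
Definition biased_pmf x : R := \prod_(i < n) bernoulli_pmf p (x i).

(* The cube is finite, so integrals against the p-biased measure are sums. *)
Definition biased_integral g : R := \sum_(x : cube n) biased_pmf x * g x.

Definition biased_norm (q : R) f : R :=
  biased_integral (fun x => `|f x| `^ q) `^ q^-1.

Definition chi1 (i : 'I_n) x : R :=
  if x i then Num.sqrt ((1 - p) / p) else - Num.sqrt (p / (1 - p)).

Definition chi S x : R := \prod_(i in S) chi1 i x.

Definition fourier_coef f S : R := biased_integral (fun x => f x * chi S x).

(* [0 ^+ 0 = 1], so T_0 f is the constant function equal to the mean of f. *)
Definition smoothing (delta : R) f : cube n -> R :=
  fun x => \sum_(S : {set 'I_n}) delta ^+ #|S| * fourier_coef f S * chi S x.

End BiasedCube.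

Section Rho.
Variables (R : realType) (p : R).
Implicit Types q delta : R.

Definition sinh (t : R) : R := (expR t - expR (- t)) / 2.

Definition bias_min : R := Num.min p (1 - p).

Definition rho_power q : R := bias_min `^ (2^-1 - q^-1).

(* For lambda = 1/2 the quotient of hyperbolic sines is 0 / 0; the value 1 is
   the limit of the whole expression as lambda tends to 1/2. *)
Definition rho_sinh q : R :=
  let L := ln (bias_min / (1 - bias_min)) in
  if bias_min == 2^-1 then 1
  else Num.sqrt (q - 1) *
       Num.sqrt (sinh (- q^-1 * L) / sinh (- (1 - q^-1) * L)).

Definition rho_const q : R := Num.sqrt (bias_min / (1 - bias_min)).

(* The functions are only meant on [2, +oo[, hence the restricted equality. *)
Definition admissible_rho (rho : R -> R) : Prop :=
  [\/ forall q, 2 <= q -> rho q = rho_power q,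
      forall q, 2 <= q -> rho q = rho_sinh q
    | forall q, 2 <= q -> rho q = rho_const q].

Definition rho1 (rho : R -> R) delta : R := rho (1 / delta ^+ 2 + 1).

(* rho1(delta) * delta, read as 0 at delta = 0. *)
Definition smoothing_rate (rho : R -> R) delta : R :=
  if delta == 0 then 0 else rho1 rho delta * delta.

End Rho.

(* Main.v *)
Require Import Defs.
From mathcomp Require Import all_boot all_order all_algebra.
From mathcomp Require Import reals sequences exp bernoulli_distribution.
From mathcomp Require Import boolp functions normedtype derive realfun.
From mathcomp Require Import convex interval_inference ring lra.

(** With r = 1 + delta^2 and tau the square of the smoothing rate,
    ||T f||_2^2 is a bilinear form in (f, f) whose kernel is a product over the
    coordinates of a nonnegative 2x2 kernel.  Peeling off one coordinate at a
    time bounds the form by ||f||_r ||g||_r, provided that this holds on one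
    coordinate, that is, provided that for a, b >= 0
      (p a + (1-p) b)^2 + tau p (1-p) (a - b)^2
        <= (p a^r + (1-p) b^r)^(2/r).
    Take p < 1/2 and put exp(2 r t0) = (1-p)/p and b/a = exp(2 (t - t0)).  For
    tau = sinh(2 (r-1) t0) / sinh(2 t0) the left side is, after normalisation,
    an affine function of cosh(2t), namely the tangent at t0 to the right side
    cosh(r t)^(2/r).  The latter is a convex function of cosh(2t), which comes
    down to sinh(k w) <= k sinh w for 0 <= k <= 1 and w >= 0.  The rates (i) and
    (iii) are at most this rate (ii), because exp is convex. *)

Set Implicit Arguments.
Unset Strict Implicit.
Unset Printing Implicit Defensive.

Import Order.TTheory GRing.Theory Num.Theory.
Import numFieldNormedType.Exports.
Local Open Scope ring_scope.

(** * Hyperbolic functions *)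

Section Hyperbolic.
Variable R : realType.
Implicit Types (r s t x y k : R).

Definition cosh t : R := (expR t + expR (- t)) / 2.

Lemma sinhE t : sinh t = (expR t - expR (- t)) / 2.
Proof. by []. Qed.

Lemma coshE t : cosh t = (expR t + expR (- t)) / 2.
Proof. by []. Qed.

Lemma sinhN t : sinh (- t) = - sinh t.
Proof. by rewrite /sinh opprK; lra. Qed.

Lemma coshN t : cosh (- t) = cosh t.
Proof. by rewrite /cosh opprK; lra. Qed.

Lemma sinh0 : sinh 0 = 0 :> R.
Proof. by rewrite /sinh oppr0; lra. Qed.

Lemma cosh0 : cosh 0 = 1 :> R.
Proof. by rewrite /cosh oppr0 expR0; lra. Qed.

Lemma sinhD x y : sinh (x + y) = sinh x * cosh y + cosh x * sinh y.
Proof. by rewrite /sinh /cosh opprD !expRD; field. Qed.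

Lemma coshD x y : cosh (x + y) = cosh x * cosh y + sinh x * sinh y.
Proof. by rewrite /sinh /cosh opprD !expRD; field. Qed.

Lemma cosh2_sinh2 x : cosh x ^+ 2 = 1 + sinh x ^+ 2.
Proof.
rewrite /sinh /cosh expRN; field.
by rewrite gt_eqF// expR_gt0.
Qed.

Lemma cosh_gt0 x : 0 < cosh x.
Proof. by rewrite divr_gt0// addr_gt0// expR_gt0. Qed.

Lemma cosh_ge1 x : 1 <= cosh x.
Proof.
rewrite -(@ler_pXn2r _ 2)// ?nnegrE ?ler01 ?(ltW (cosh_gt0 _))//.
by rewrite cosh2_sinh2 expr1n lerDl sqr_ge0.
Qed.

Lemma sinh_gt0 x : 0 < x -> 0 < sinh x.
Proof. by move=> x0; rewrite divr_gt0// subr_gt0 ltr_expR; lra. Qed.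

Lemma is_derive_sinh k x :
  is_derive x 1 (fun t => sinh (k * t)) (k * cosh (k * x)).
Proof.
have h (c : R) : is_derive x 1 (fun t => expR (c * t)) (expR (c * x) * c).
  apply: (@is_derive1_comp _ expR ( *%R c)).
  by apply: is_derive_eq; rewrite /GRing.scale/= mulr1.
rewrite (_ : (fun t => _) =
    (2^-1 : R) \*: ((fun t => expR (k * t)) - (fun t => expR (- k * t)))).
  by apply: is_derive_eq; rewrite /GRing.scale/= /cosh mulNr; lra.
by apply/funext => t; rewrite /sinh /GRing.scale/= !fctE /= -mulNr mulrC.
Qed.

Lemma is_derive_cosh k x :
  is_derive x 1 (fun t => cosh (k * t)) (k * sinh (k * x)).
Proof.
have h (c : R) : is_derive x 1 (fun t => expR (c * t)) (expR (c * x) * c).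
  apply: (@is_derive1_comp _ expR ( *%R c)).
  by apply: is_derive_eq; rewrite /GRing.scale/= mulr1.
rewrite (_ : (fun t => _) =
    (2^-1 : R) \*: ((fun t => expR (k * t)) + (fun t => expR (- k * t)))).
  by apply: is_derive_eq; rewrite /GRing.scale/= /sinh mulNr; lra.
by apply/funext => t; rewrite /cosh /GRing.scale/= !fctE /= -mulNr mulrC.
Qed.

(** The sign of the derivative is asked only in the interior, so that the endpoint 0, where
    [cosh_slope] divides by zero, is harmless. *)
Lemma ge0_derive_le (f df : R -> R) a b : a <= b ->
  {in `[a, b], forall x, is_derive x 1 f (df x)} ->
  {in `]a, b[, forall x, 0 <= df x} -> f a <= f b.
Proof.
rewrite le_eqVlt => /predU1P[->//|ab] fdf df0.
have sub x : x \in `]a, b[ -> x \in `[a, b] by apply: subset_itv_oo_cc.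
have [] := @MVT R f df a b ab.
- by move=> x /sub; exact: fdf.
- by apply: derivable_within_continuous => x /fdf [].
by move=> c /df0 c0 fE; rewrite -subr_ge0 fE mulr_ge0// subr_ge0 ltW.
Qed.

Lemma ler_cosh x y : 0 <= x -> x <= y -> cosh x <= cosh y.
Proof.
move=> x0 xy; rewrite -[x]mul1r -[y]mul1r.
apply: (@ge0_derive_le (fun t => cosh (1 * t)) (fun t => 1 * sinh (1 * t))) => //.
  by move=> t _; exact: is_derive_cosh.
move=> t; rewrite in_itv/= => /andP[xt _].
by rewrite !mul1r ltW// sinh_gt0// (le_lt_trans x0).
Qed.

(** The difference of the two sides vanishes at 0 and has derivative [k * (cosh x - cosh (k * x))],
    which is nonnegative. *)
Lemma sinh_scale_le k x : 0 <= k -> k <= 1 -> 0 <= x -> sinh (k * x) <= k * sinh x.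
Proof.
move=> k0 k1 x0.
have := @ge0_derive_le (fun t => k * sinh (1 * t) - sinh (k * t))
  (fun t => k * (1 * cosh (1 * t)) - k * cosh (k * t)) 0 x x0.
rewrite !mulr0 sinh0 mulr0 subr0 mul1r subr_ge0; apply.
  move=> t _; have := is_derive_sinh 1 t; have := is_derive_sinh k t.
  move=> h1 h2.
  rewrite (_ : (fun t => _) =
    k \*: (fun t => sinh (1 * t)) - (fun t => sinh (k * t)))//.
  exact: is_derive_eq.
move=> t; rewrite in_itv/= => /andP[t0 _].
rewrite !mul1r -mulrBr mulr_ge0// subr_ge0 ler_cosh ?mulr_ge0 ?(ltW t0)//.
by rewrite ler_piMl// ltW.
Qed.

End Hyperbolic.

(** * Convexity of cosh(r t)^(2/r) as a function of cosh(2t) *)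

Section Slope.
Variables (R : realType) (r : R).
Implicit Types (s t x y k : R).

(* The derivative of [cosh (r * t) `^ (2 / r)] with respect to [cosh (2 * t)]. *)
Definition cosh_slope t : R :=
  cosh (r * t) `^ (2 / r - 1) * sinh (r * t) / sinh (2 * t).

Lemma cosh_slope_gt0 t : 0 < r -> 0 < t -> 0 < cosh_slope t.
Proof.
move=> r0 t0; apply: divr_gt0; last by apply: sinh_gt0; exact: mulr_gt0.
by apply: mulr_gt0; [exact/powR_gt0/cosh_gt0|exact/sinh_gt0/mulr_gt0].
Qed.

(** This is the logarithmic derivative of [cosh_slope]. Multiplied by [cosh (r * t) * sinh (r * t) *
    sinh (2 * t)], it becomes [(r - 1) * sinh (2 * t) - sinh ((r - 1) * (2 * t))]. *)
Lemma log_slope_derive_ge0 t : 1 <= r -> r <= 2 -> 0 < t ->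
  0 <= (2 / r - 1) * (r * sinh (r * t) / cosh (r * t)) +
    (r * cosh (r * t) / sinh (r * t) - 2 * cosh (2 * t) / sinh (2 * t)).
Proof.
move=> r1 r2 t0; have r0 : 0 < r by lra.
have S0 : 0 < sinh (r * t) by rewrite sinh_gt0 ?mulr_gt0.
have s0 : 0 < sinh (2 * t) by rewrite sinh_gt0 ?mulr_gt0.
have C0 := cosh_gt0 (r * t).
have H : sinh ((r - 1) * (2 * t)) <= (r - 1) * sinh (2 * t).
  by apply: sinh_scale_le; lra.
have E : (r - 1) * (2 * t) = (r * t + r * t) + - (2 * t) by ring.
move: H; rewrite E !(sinhD (_ + _)) (sinhD (r * t)) (coshD (r * t)) coshN sinhN.
rewrite -[cosh (r * t) * cosh (r * t)]expr2 cosh2_sinh2 => H.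
rewrite -(@pmulr_rge0 _ (cosh (r * t) * sinh (r * t) * sinh (2 * t))); last first.
  exact: mulr_gt0 (mulr_gt0 C0 S0) s0.
rewrite [leRHS](_ : _ = ((2 - r) * sinh (r * t) ^+ 2 + r * cosh (r * t) ^+ 2)
   * sinh (2 * t) - 2 * cosh (2 * t) * cosh (r * t) * sinh (r * t)); last first.
  by field; rewrite !gt_eqF.
rewrite cosh2_sinh2. lra.
Qed.

Lemma cosh_slope_le s t : 1 <= r -> r <= 2 -> 0 < s -> s <= t ->
  cosh_slope s <= cosh_slope t.
Proof.
move=> r1 r2 s0 st; have r0 : 0 < r by lra.
pose f x := (2 / r - 1) * ln (cosh (r * x)) +
  (ln (sinh (r * x)) - ln (sinh (2 * x))).
have fE x : 0 < x -> cosh_slope x = expR (f x).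
  move=> x0; rewrite /cosh_slope /f !expRD expRN !lnK ?posrE ?sinh_gt0 ?mulr_gt0//.
  by rewrite /powR gt_eqF ?cosh_gt0// mulrA.
have t0 := lt_le_trans s0 st.
rewrite (fE _ s0) (fE _ t0) ler_expR.
pose df x := (2 / r - 1) * (r * sinh (r * x) / cosh (r * x)) +
  (r * cosh (r * x) / sinh (r * x) - 2 * cosh (2 * x) / sinh (2 * x)).
apply: (@ge0_derive_le R f df _ _ st); last first.
  move=> x; rewrite in_itv/= => /andP[sx _].
  by apply: log_slope_derive_ge0 => //; exact: lt_trans sx.
move=> x; rewrite in_itv/= => /andP[sx _].
have x0 := lt_le_trans s0 sx.
have h1 : is_derive x 1 (fun x => ln (cosh (r * x)))
    ((cosh (r * x))^-1 * (r * sinh (r * x))).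
  apply: (@is_derive1_comp _ (@ln R)).
    by apply: is_derive1_ln; exact: cosh_gt0.
  exact: is_derive_cosh.
have h2 k : 0 < k -> is_derive x 1 (fun x => ln (sinh (k * x)))
    ((sinh (k * x))^-1 * (k * cosh (k * x))).
  move=> k0; apply: (@is_derive1_comp _ (@ln R)).
    by apply: is_derive1_ln; rewrite sinh_gt0 ?mulr_gt0.
  exact: is_derive_sinh.
have h3 := h2 _ r0; have h4 := h2 2 ltac:(lra).
apply: (is_derive_eq (is_deriveD (is_deriveZ (2 / r - 1) h1) (is_deriveB h3 h4))).
rewrite /GRing.scale/=.
by congr (_ * _ + (_ - _)); rewrite mulrC.
Qed.

(* [r / 2] is the limit of the slope at 0: [cosh_slope s * cosh s >= r / 2] and
   [cosh s] is as close to 1 as desired for small [s]. *)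
Lemma cosh_slope_ge t : 1 <= r -> r <= 2 -> 0 < t -> r / 2 <= cosh_slope t.
Proof.
move=> r1 r2 t0; have r0 : 0 < r by lra.
rewrite leNgt; apply/negP => gt.
have g0 := cosh_slope_gt0 r0 t0.
pose K := (r / 2) / cosh_slope t.
have K1 : 1 < K by rewrite ltr_pdivlMr// mul1r.
(* The bound [s <= ln K] forces [cosh s < expR s <= K]. *)
pose s := Num.min t (ln K).
have s0 : 0 < s by rewrite lt_min t0 ln_gt0.
have st : s <= t by rewrite ge_min lexx.
have sK : expR s <= K.
  rewrite -[leRHS](@lnK _ K) ?posrE ?(lt_trans _ K1)// ler_expR.
  by rewrite ge_min lexx orbT.
have cs : cosh s < K.
  apply: lt_le_trans sK; rewrite !coshE.
  have : expR (- s) < expR s by rewrite ltr_expR; lra.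
  lra.
have : r / 2 <= cosh_slope s * cosh s.
  (* As sinh(2s) = 2 sinh(s) cosh(s), the factor cosh(s) cancels. The power is at least 1, and
     [sinh_scale_le] at k = 1/r bounds the quotient below by r/2. *)
  have -> : cosh_slope s * cosh s =
      cosh (r * s) `^ (2 / r - 1) * (sinh (r * s) / (2 * sinh s)).
    rewrite /cosh_slope (_ : 2 * s = s + s); last by ring.
    rewrite sinhD.
    have := sinh_gt0 s0; have := cosh_gt0 s => h1 h2.
    field; rewrite !gt_eqF//.
    by rewrite addr_gt0// mulr_gt0.
  have ss : 0 < 2 * sinh s by exact: mulr_gt0 _ (sinh_gt0 s0).
  apply: (@le_trans _ _ (sinh (r * s) / (2 * sinh s))).
    rewrite (ler_pdivlMr _ _ ss).
    have : sinh (r^-1 * (r * s)) <= r^-1 * sinh (r * s).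
      by apply: sinh_scale_le; rewrite ?mulr_ge0 ?invr_ge0 ?invf_le1// ltW.
    by rewrite mulKf ?gt_eqF// ler_pdivlMl// => h; lra.
  rewrite ler_peMl//.
    by apply/ltW/(divr_gt0 _ ss)/sinh_gt0; exact: mulr_gt0.
  have e0 : 0 <= 2 / r - 1 by rewrite subr_ge0 ler_pdivlMr// mul1r.
  have := @ge0_ler_powR R _ e0 1 (cosh (r * s)).
  by rewrite powR1 !nnegrE ler01 ltW ?cosh_gt0// cosh_ge1; apply.
have := cosh_slope_le r1 r2 s0 st.
have := cosh_gt0 s.
have KE : K * cosh_slope t = r / 2 by rewrite mulfVK ?gt_eqF.
nra.
Qed.

(** On t >= 0, the function cosh(r t)^(2/r) - c cosh(2t) decreases before t0 and increases after it.
    A free [c], instead of [cosh_slope t0], allows t0 = 0, where the slope exists only as a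
    limit. *)
Lemma cosh_powR_tangent c t0 t : 0 < r -> 0 <= t0 -> 0 <= t ->
  (forall x, 0 < x -> x < t0 -> cosh_slope x <= c) ->
  (forall x, t0 < x -> c <= cosh_slope x) ->
  cosh (r * t0) `^ (2 / r) + c * (cosh (2 * t) - cosh (2 * t0))
    <= cosh (r * t) `^ (2 / r).
Proof.
move=> r0 t00 t_ge0 lc uc.
pose f x := cosh (r * x) `^ (2 / r) - c * cosh (2 * x).
pose df x := 2 * (cosh (r * x) `^ (2 / r - 1) * sinh (r * x)) -
  c * (2 * sinh (2 * x)).
have fdf x : is_derive x 1 f (df x).
  have h1 : is_derive x 1 (fun x => cosh (r * x) `^ (2 / r))
      ((2 / r * cosh (r * x) `^ (2 / r - 1)) * (r * sinh (r * x))).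
    apply: (@is_derive1_comp _ ((@powR R)^~ (2 / r))).
      by apply: is_derive1_powR; exact: cosh_gt0.
    exact: is_derive_cosh.
  have h2 := is_derive_cosh 2 x.
  rewrite (_ : f = (fun x => cosh (r * x) `^ (2 / r)) -
    c \*: (fun x => cosh (2 * x)))//.
  apply: is_derive_eq; rewrite /GRing.scale/= /df.
  by congr (_ - _); field; rewrite gt_eqF.
have dfE x : 0 < x -> df x = 2 * sinh (2 * x) * (cosh_slope x - c).
  move=> x0; rewrite /df /cosh_slope; field.
  by rewrite gt_eqF// sinh_gt0// mulr_gt0.
suff : f t0 <= f t.
  by rewrite /f mulrBr lerBrDr -addrA [- _ + _]addrC.
have [tt0|t0t] := leP t t0.
  rewrite -lerN2; apply: (@ge0_derive_le R (- f) (- df)) => // x.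
    by move=> _; have := fdf x => ?; exact: is_derive_eq.
  rewrite in_itv/= => /andP[tx xt0]; have x0 := le_lt_trans t_ge0 tx.
  rewrite !fctE dfE// oppr_ge0 mulr_ge0_le0 ?subr_le0 ?lc//.
  by apply/ltW/mulr_gt0 => //; apply: sinh_gt0; exact: mulr_gt0.
apply: (@ge0_derive_le R f df); rewrite ?ltW// => x.
rewrite in_itv/= => /andP[tx xt0]; have x0 := le_lt_trans t00 tx.
rewrite dfE// mulr_ge0 ?subr_ge0 ?uc//.
by apply/ltW/mulr_gt0 => //; apply: sinh_gt0; exact: mulr_gt0.
Qed.

End Slope.

(** * The two-point inequality *)

Section TwoPoint.
Variable R : realType.
Implicit Types (p r tau a b e s t x y z : R).

(** For f with values a and b on one coordinate, the left side is the squared mean plus [tau] times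
    the variance, that is ||T f||_2^2 when [tau] is the square of the rate. *)
Definition two_point p r tau := forall a b, 0 <= a -> 0 <= b ->
  (p * a + (1 - p) * b) ^+ 2 + tau * (p * (1 - p)) * (a - b) ^+ 2
    <= (p * a `^ r + (1 - p) * b `^ r) `^ (2 / r).

(** Common part of the cases t0 > 0 (p < 1/2) and t0 = 0 (p = 1/2). The last hypothesis makes the
    normalised left side affine in cosh(2(t0 + s)), and [k] is its slope relative to its value at s
    = 0. *)
Lemma two_point_tangent r t0 k tau a b :
  0 < r -> 0 <= t0 -> 0 < a -> 0 < b ->
  let C := cosh (r * t0) in let p := expR (- (r * t0)) / (2 * C) in
  (forall x, 0 < x -> x < t0 -> cosh_slope r x <= C `^ (2 / r) * k) ->
  (forall x, t0 < x -> C `^ (2 / r) * k <= cosh_slope r x) ->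
  (forall s, cosh (r * t0 + s) ^+ 2 + tau * sinh s ^+ 2 =
     C ^+ 2 * (1 + k * (cosh (2 * (t0 + s)) - cosh (2 * t0)))) ->
  (p * a + (1 - p) * b) ^+ 2 + tau * (p * (1 - p)) * (a - b) ^+ 2
    <= (p * a `^ r + (1 - p) * b `^ r) `^ (2 / r).
Proof.
move=> r0 t00 a0 b0 C p lc uc idE.
have C0 : 0 < C by exact: cosh_gt0.
have qE : 1 - p = expR (r * t0) / (2 * C).
  rewrite /p /C !coshE; field.
  by rewrite gt_eqF// addr_gt0// expR_gt0.
(* [expR m] is the geometric mean of a and b, and t0 + s is the variable t in which the two sides
   are compared. *)
pose m := (ln a + ln b) / 2; pose s := (ln b - ln a) / 2.
have aE : a = expR (m - s).
  by rewrite -[LHS]lnK ?posrE//; congr expR; rewrite /m /s; field.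
have bE : b = expR (m + s).
  by rewrite -[LHS]lnK ?posrE//; congr expR; rewrite /m /s; field.
have powE x : expR x `^ r = expR (r * x) by rewrite -expRM mulrC.
have -> : p * a `^ r + (1 - p) * b `^ r =
    expR (m * r) * (cosh (r * (t0 + s)) / C).
  rewrite qE /p aE bE !powE (coshE (r * (t0 + s))) !mulrDr !opprD mulrN !expRD.
  rewrite [m * r]mulrC.
  by field; rewrite gt_eqF.
have Lpos : 0 <= cosh (r * (t0 + s)) by exact/ltW/cosh_gt0.
have Cinv : 0 <= C^-1 by rewrite invr_ge0 ltW.
rewrite (powRM _ (expR_ge0 _) (mulr_ge0 Lpos Cinv)) (powRM _ Lpos Cinv).
rewrite -expRM (_ : m * r * (2 / r) = m * 2); last by field; rewrite gt_eqF.
have -> : (p * a + (1 - p) * b) ^+ 2 + tau * (p * (1 - p)) * (a - b) ^+ 2 =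
    expR (m * 2) / C ^+ 2 * (cosh (r * t0 + s) ^+ 2 + tau * sinh s ^+ 2).
  rewrite qE /p aE bE (coshE (r * t0 + s)) (sinhE s).
  rewrite !opprD !expRD !expRN (_ : m * 2 = m + m); last by ring.
  rewrite expRD; field.
  by rewrite !gt_eqF ?expR_gt0.
rewrite idE (_ : _ / _ * (_ * _) = expR (m * 2) *
    (1 + k * (cosh (2 * (t0 + s)) - cosh (2 * t0)))); last first.
  by field; rewrite gt_eqF.
rewrite ler_pM2l ?expR_gt0//.
have P0 : 0 < C `^ (2 / r) by exact: powR_gt0.
have -> : C^-1 `^ (2 / r) = (C `^ (2 / r))^-1.
  by rewrite -powR_inv1 ?(ltW C0)// -powRrM mulN1r powRN.
rewrite (ler_pdivlMr _ _ P0).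
(* Both sides are even in t0 + s, while the tangent bound is for nonnegative arguments. *)
have := @cosh_powR_tangent R r _ t0 `|t0 + s| r0 t00 (normr_ge0 _) lc uc.
have cosh_norm c : 0 <= c -> cosh (c * `|t0 + s|) = cosh (c * (t0 + s)).
  move=> c0; have [_|_] := ger0P (t0 + s) => //.
  by rewrite mulrN coshN.
rewrite (cosh_norm _ (ltW r0)) (cosh_norm _ (ler0n _ 2)) -/C => h.
by apply: le_trans h; rewrite le_eqVlt; apply/orP; left; apply/eqP; ring.
Qed.

(** This [tau] is the one value for which cosh(r t0 + s)^2 + tau sinh(s)^2 is affine in cosh(2(t0 +
    s)), without a term in sinh(2(t0 + s)). *)
Lemma two_point_sharp_pos r t0 a b :
  1 <= r -> r <= 2 -> 0 < t0 -> 0 < a -> 0 < b ->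
  let p := expR (- (r * t0)) / (2 * cosh (r * t0)) in
  let tau := sinh (2 * ((r - 1) * t0)) / sinh (2 * t0) in
  (p * a + (1 - p) * b) ^+ 2 + tau * (p * (1 - p)) * (a - b) ^+ 2
    <= (p * a `^ r + (1 - p) * b `^ r) `^ (2 / r).
Proof.
move=> r1 r2 t0_gt0 a0 b0 /=; set tau := _ / sinh (2 * t0).
have r0 : 0 < r by lra.
have C0 := cosh_gt0 (r * t0).
have S0 : 0 < sinh (2 * t0) by apply: sinh_gt0; exact: mulr_gt0.
pose k := sinh (r * t0) / (cosh (r * t0) * sinh (2 * t0)).
have kE : cosh (r * t0) `^ (2 / r) * k = cosh_slope r t0.
  rewrite /cosh_slope powRB ?(gt_eqF C0) ?implybT// powRr1 ?(ltW C0)// /k.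
  by field; rewrite !gt_eqF.
apply: (@two_point_tangent r t0 k) => //; rewrite ?ltW// ?kE.
- by move=> x x0 xt; rewrite cosh_slope_le// ltW.
- by move=> x xt; rewrite cosh_slope_le// ltW.
move=> s; rewrite /tau /k.
have <- : 2 * (r * t0) - 2 * t0 = 2 * ((r - 1) * t0) by ring.
have -> : 2 * (t0 + s) = 2 * t0 + (s + s) by ring.
have -> : 2 * (r * t0) = r * t0 + r * t0 by ring.
apply: (@mulIf _ (sinh (2 * t0))); first by rewrite gt_eqF.
rewrite [LHS](_ : _ = cosh (r * t0 + s) ^+ 2 * sinh (2 * t0) +
  sinh (r * t0 + r * t0 - 2 * t0) * sinh s ^+ 2); last first.
  by field; rewrite gt_eqF.
rewrite [RHS](_ : _ = cosh (r * t0) ^+ 2 * sinh (2 * t0) + cosh (r * t0) *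
   sinh (r * t0) * (cosh (2 * t0 + (s + s)) - cosh (2 * t0))); last first.
  by field; rewrite !gt_eqF.
rewrite !(coshD, sinhD) coshN sinhN.
have e := cosh2_sinh2 s.
apply/eqP; rewrite -subr_eq0; apply/eqP.
(* After expansion, the difference of the two sides is a multiple of cosh(s)^2 - sinh(s)^2 - 1. *)
rewrite [LHS](_ : _ = (cosh s ^+ 2 - (1 + sinh s ^+ 2)) *
  (cosh (r * t0) ^+ 2 * sinh (2 * t0) -
   cosh (r * t0) * sinh (r * t0) * cosh (2 * t0))).
  by rewrite e subrr mul0r.
by ring.
Qed.

(** Here t0 = 0: no positive number lies below t0, and the tangent slope is the limit r/2, which
    [cosh_slope_ge] puts below all slopes. *)
Lemma two_point_sharp_half_pos r a b :
  1 <= r -> r <= 2 -> 0 < a -> 0 < b ->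
  (2^-1 * a + (1 - 2^-1) * b) ^+ 2 +
    (r - 1) * (2^-1 * (1 - 2^-1)) * (a - b) ^+ 2
    <= (2^-1 * a `^ r + (1 - 2^-1) * b `^ r) `^ (2 / r).
Proof.
move=> r1 r2 a0 b0.
have r0 : 0 < r by lra.
have := @two_point_tangent r 0 (r / 2) (r - 1) a b r0 (lexx _) a0 b0.
rewrite /= mulr0 cosh0 powR1 mul1r oppr0 expR0 mulr1 div1r; apply.
- by move=> x x0; rewrite ltNge ltW.
- by move=> x x0; rewrite cosh_slope_ge.
move=> s; have -> : 2 * (0 + s) = s + s by ring.
rewrite !add0r mulr0 cosh0 coshD -!expr2 cosh2_sinh2.
by field.
Qed.

(** Right continuity of the power at y, including y = 0, obtained by taking roots on both sides. *)
Lemma le_powR_addgt0 x y e : 0 <= x -> 0 <= y -> 0 < e ->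
  (forall z, 0 < z -> x <= (y + z) `^ e) -> x <= y `^ e.
Proof.
move=> x0 y0 e0 H.
have ei0 : 0 <= e^-1 by rewrite invr_ge0 ltW.
have h : x `^ e^-1 <= y.
  apply/ler_addgt0Pr => z z0.
  have yz0 : 0 <= y + z by rewrite addr_ge0// ltW.
  rewrite -[leRHS](powRr1 yz0) -(mulfV (lt0r_neq0 e0)) powRrM.
  by apply: ge0_ler_powR; rewrite ?nnegrE ?powR_ge0// H.
rewrite -[leLHS]powRr1// -(mulVf (lt0r_neq0 e0)) powRrM.
by apply: ge0_ler_powR; rewrite ?nnegrE ?powR_ge0// ltW.
Qed.

(** A zero value is replaced by the [c] whose weighted r-th power is exactly [z]. The right side
    becomes (y + z)^(2/r), and the left side can only grow, since its coefficients are nonnegative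
    for 0 <= tau <= 1. *)
Lemma two_point_closure p r tau : 0 < p -> p < 1 -> 0 < r -> 0 <= tau <= 1 ->
  (forall a b, 0 < a -> 0 < b ->
    (p * a + (1 - p) * b) ^+ 2 + tau * (p * (1 - p)) * (a - b) ^+ 2
      <= (p * a `^ r + (1 - p) * b `^ r) `^ (2 / r)) ->
  two_point p r tau.
Proof.
move=> p0 p1 r0 /andP[tau0 tau1] H.
have q0 : 0 < 1 - p by lra.
have pq0 : 0 < p * (1 - p) by exact: mulr_gt0.
have e0 : 0 < 2 / r by exact: divr_gt0.
have rootE w z : 0 < w -> 0 < z -> w * ((z / w) `^ r^-1) `^ r = z.
  move=> w0 z0; rewrite -powRrM mulVf ?(gt_eqF r0)// powRr1 ?divr_ge0 ?ltW//.
  by field; rewrite gt_eqF.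
have Q0 a b : 0 <= (p * a + (1 - p) * b) ^+ 2 + tau * (p * (1 - p)) * (a - b) ^+ 2.
  by rewrite addr_ge0 ?sqr_ge0// mulr_ge0 ?sqr_ge0 ?mulr_ge0// ltW.
have QE a b : (p * a + (1 - p) * b) ^+ 2 + tau * (p * (1 - p)) * (a - b) ^+ 2 =
  (p ^+ 2 + tau * (p * (1 - p))) * a ^+ 2 + 2 * ((1 - tau) * (p * (1 - p))) * (a * b)
  + ((1 - p) ^+ 2 + tau * (p * (1 - p))) * b ^+ 2 by ring.
have k0 x : 0 <= x ^+ 2 + tau * (p * (1 - p)).
  by rewrite addr_ge0 ?sqr_ge0// mulr_ge0// ltW.
have m0 : 0 <= (1 - tau) * (p * (1 - p)).
  by rewrite mulr_ge0 ?subr_ge0 ?(ltW pq0).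
have r00 : 0 `^ r = 0 :> R by rewrite powR0// gt_eqF.
move=> a b; rewrite le_eqVlt => /predU1P[<-|a0];
  rewrite le_eqVlt => /predU1P[<-|b0].
- by rewrite !mulr0 subr0 addr0 expr0n/= mulr0 addr0 powR_ge0.
- rewrite [X in X `^ (2 / r)](_ : _ = (1 - p) * b `^ r); last first.
    by rewrite r00 mulr0 add0r.
  apply: le_powR_addgt0 => // [|z z0]; first by rewrite mulr_ge0 ?powR_ge0 ?ltW.
  pose c := (z / p) `^ r^-1.
  have c0 : 0 < c by rewrite powR_gt0// divr_gt0.
  have := H _ _ c0 b0; rewrite rootE// [z + _]addrC; apply: le_trans.
  rewrite !QE expr0n/= mulr0 mul0r mulr0 !add0r lerDr.
  apply: addr_ge0; first exact: mulr_ge0 (k0 _) (sqr_ge0 _).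
  exact: mulr_ge0 (mulr_ge0 (ler0n _ 2) m0) (mulr_ge0 (ltW c0) (ltW b0)).
- rewrite [X in X `^ (2 / r)](_ : _ = p * a `^ r); last first.
    by rewrite r00 mulr0 addr0.
  apply: le_powR_addgt0 => // [|z z0]; first by rewrite mulr_ge0 ?powR_ge0 ?ltW.
  pose c := (z / (1 - p)) `^ r^-1.
  have c0 : 0 < c by rewrite powR_gt0// divr_gt0.
  have := H _ _ a0 c0; rewrite rootE//; apply: le_trans.
  rewrite !QE expr0n/= !mulr0 !addr0 -addrA lerDl.
  apply: addr_ge0; last exact: mulr_ge0 (k0 _) (sqr_ge0 _).
  exact: mulr_ge0 (mulr_ge0 (ler0n _ 2) m0) (mulr_ge0 (ltW a0) (ltW c0)).
- exact: H.
Qed.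

Lemma two_point_mono p r tau tau' : 0 <= p -> p <= 1 -> tau <= tau' ->
  two_point p r tau' -> two_point p r tau.
Proof.
move=> p0 p1 tau_le H a b a0 b0; apply: le_trans (H a b a0 b0).
by rewrite lerD2l ler_wpM2r ?sqr_ge0// ler_wpM2r// mulr_ge0 ?subr_ge0.
Qed.

Lemma two_point_sym p r tau : two_point (1 - p) r tau -> two_point p r tau.
Proof.
move=> H a b a0 b0; have := H b a b0 a0.
rewrite subKr [in leRHS]addrC; apply: le_trans.
by rewrite le_eqVlt; apply/orP; left; apply/eqP; ring.
Qed.

Lemma two_point_r1 p : 0 <= p -> p <= 1 -> two_point p 1 0.
Proof.
move=> p0 p1 a b a0 b0; rewrite !mul0r addr0 divr1 !powRr1//.
by rewrite (powR_mulrn 2)// addr_ge0// mulr_ge0// subr_ge0.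
Qed.

End TwoPoint.

(** * Tensorization *)

Section Cube.
Variables (R : realType) (n : nat).
Implicit Types (b : bool).

Definition cube_cons b (y : cube n) : cube n.+1 :=
  [ffun i => oapp y b (unlift ord0 i)].

Lemma cube_cons0 b y : cube_cons b y ord0 = b.
Proof. by rewrite ffunE unlift_none. Qed.

Lemma cube_consS b y i : cube_cons b y (lift ord0 i) = y i.
Proof. by rewrite ffunE liftK. Qed.

Lemma sum_cubeS (F : cube n.+1 -> R) :
  \sum_x F x = \sum_b \sum_y F (cube_cons b y).
Proof.
rewrite pair_big/= (reindex (fun u : bool * cube n => cube_cons u.1 u.2))//=.
exists (fun x : cube n.+1 => (x ord0, [ffun i => x (lift ord0 i)] : cube n)).
  move=> [b y] _ /=; rewrite cube_cons0; congr pair.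
  by apply/ffunP => i; rewrite ffunE cube_consS.
move=> x _ /=; apply/ffunP => i; rewrite ffunE.
by case: unliftP => [j ->|->]/=; rewrite ?ffunE.
Qed.

End Cube.

Lemma sum_cube0 (R : realType) (F : cube 0 -> R) (x : cube 0) : \sum_y F y = F x.
Proof.
rewrite (bigD1 x)//= big1 ?addr0// => y /eqP[]; apply/ffunP => -[] //.
Qed.

Section Kernel.
Variables (R : realType) (p : R).
Implicit Types (r tau s : R) (b c : bool).

Definition char_bit b : R :=
  if b then Num.sqrt ((1 - p) / p) else - Num.sqrt (p / (1 - p)).

(** For tau = s^2, the kernel of the form <T_s u, T_s v> on one coordinate, with the point masses
    included. *)
Definition noise_kernel tau b c : R :=
  bernoulli_pmf p b * bernoulli_pmf p c * (1 + tau * (char_bit b * char_bit c)).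

Hypotheses (p0 : 0 < p) (p1 : p < 1).

Let q0 : 0 < 1 - p. Proof. by rewrite subr_gt0. Qed.

Lemma char_bitE b c : char_bit b * char_bit c =
  match b, c with
  | true, true => (1 - p) / p
  | false, false => p / (1 - p)
  | _, _ => -1
  end.
Proof.
have E : Num.sqrt ((1 - p) / p) * Num.sqrt (p / (1 - p)) = 1.
  rewrite -sqrtrM ?divr_ge0 ?ltW//.
  by rewrite (_ : _ * _ = 1) ?sqrtr1//; field; rewrite !gt_eqF.
case: b c => -[]; rewrite /char_bit.
- by rewrite -expr2 sqr_sqrtr// divr_ge0 ?ltW.
- by rewrite mulrN E.
- by rewrite mulNr mulrC E.
- by rewrite mulrNN -expr2 sqr_sqrtr// divr_ge0 ?ltW.
Qed.

Lemma noise_kernelE tau b c : noise_kernel tau b c =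
  match b, c with
  | true, true => p ^+ 2 + tau * (p * (1 - p))
  | false, false => (1 - p) ^+ 2 + tau * (p * (1 - p))
  | _, _ => (1 - tau) * (p * (1 - p))
  end.
Proof.
by rewrite /noise_kernel char_bitE; case: b c => -[] /=; field; rewrite ?gt_eqF.
Qed.

Lemma noise_kernel_ge0 tau b c : 0 <= tau <= 1 -> 0 <= noise_kernel tau b c.
Proof.
move=> /andP[t0 t1]; have pq : 0 <= p * (1 - p) by apply/ltW/mulr_gt0.
rewrite noise_kernelE; case: b c => -[].
- by rewrite addr_ge0 ?sqr_ge0// mulr_ge0.
- by rewrite mulr_ge0 ?subr_ge0.
- by rewrite mulr_ge0 ?subr_ge0.
- by rewrite addr_ge0 ?sqr_ge0// mulr_ge0.
Qed.

(** The functions 1 and [char_bit] are orthonormal, so composing two kernels of rate s gives the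
    kernel of rate s^2. *)
Lemma noise_kernel_conv s b c :
  \sum_a bernoulli_pmf p a *
    ((1 + s * (char_bit b * char_bit a)) * (1 + s * (char_bit c * char_bit a)))
  = 1 + s ^+ 2 * (char_bit b * char_bit c).
Proof.
rewrite big_bool !char_bitE /bernoulli_pmf.
by case: b c => -[] /=; field; rewrite ?gt_eqF.
Qed.

(* The two-point quadratic form is positive semidefinite; this is its
   Cauchy-Schwarz inequality combined with the bound on the diagonal. *)
Lemma two_point_bilinear r tau (u v : bool -> R) :
  0 < r -> 0 <= tau <= 1 -> two_point p r tau ->
  (forall b, 0 <= u b) -> (forall b, 0 <= v b) ->
  \sum_b \sum_c noise_kernel tau b c * (u b * v c) <=
  (\sum_b bernoulli_pmf p b * u b `^ r) `^ r^-1 *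
  (\sum_b bernoulli_pmf p b * v b `^ r) `^ r^-1.
Proof.
move=> r0 t01 H u0 v0; have /andP[t0 t1] := t01.
have pq : 0 <= p * (1 - p) by apply/ltW/mulr_gt0.
rewrite -(@ler_pXn2r _ 2)// ?nnegrE ?mulr_ge0 ?powR_ge0//; last first.
  apply: sumr_ge0 => b _; apply: sumr_ge0 => c _.
  exact: mulr_ge0 (noise_kernel_ge0 _ _ t01) (mulr_ge0 (u0 b) (v0 c)).
have sqE x : (x `^ r^-1) ^+ 2 = x `^ (2 / r).
  by rewrite -powR_mulrn ?powR_ge0// -powRrM mulrC.
rewrite exprMn [X in _ <= X * _]sqE [X in _ <= _ * X]sqE !big_bool /= !noise_kernelE.
have Hu := H _ _ (u0 true) (u0 false).
have Hv := H _ _ (v0 true) (v0 false).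
apply: le_trans (ler_pM _ _ Hu Hv); last 2 first.
- exact: addr_ge0 (sqr_ge0 _) (mulr_ge0 (mulr_ge0 t0 pq) (sqr_ge0 _)).
- exact: addr_ge0 (sqr_ge0 _) (mulr_ge0 (mulr_ge0 t0 pq) (sqr_ge0 _)).
(* Lagrange's identity: for a binary quadratic form, the product of two values minus the squared
   bilinear value is the determinant, here tau p (1 - p), times a squared 2x2 minor. *)
rewrite -subr_ge0 [leRHS](_ : _ = tau * (p * (1 - p)) *
  (u true * v false - u false * v true) ^+ 2); last by ring.
by rewrite mulr_ge0 ?sqr_ge0// mulr_ge0.
Qed.

Lemma biased_pmf_ge0 n (x : cube n) : 0 <= biased_pmf p x.
Proof. by apply: prodr_ge0 => i _; rewrite bernoulli_pmf_ge0// !ltW. Qed.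

Lemma biased_integral_ge0 n (g : cube n -> R) : (forall x, 0 <= g x) ->
  0 <= biased_integral p g.
Proof. by move=> g0; apply: sumr_ge0 => x _; rewrite mulr_ge0 ?biased_pmf_ge0. Qed.

Lemma biased_norm_powR n r (f : cube n -> R) : 0 < r ->
  biased_norm p r f `^ r = biased_integral p (fun x => `|f x| `^ r).
Proof.
move=> r0; rewrite -powRrM mulVf ?gt_eqF// powRr1//.
by apply: biased_integral_ge0 => x; rewrite powR_ge0.
Qed.

Lemma biased_normS n r (f : cube n.+1 -> R) : 0 < r ->
  biased_norm p r f =
  (\sum_b bernoulli_pmf p b * biased_norm p r (f \o cube_cons b) `^ r) `^ r^-1.
Proof.
move=> r0; rewrite /biased_norm; congr (_ `^ _).
rewrite [LHS]sum_cubeS; apply: eq_bigr => b _.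
rewrite biased_norm_powR// mulr_sumr; apply: eq_bigr => y _.
rewrite mulrA; congr (_ * _).
rewrite /biased_pmf big_ord_recl cube_cons0; congr (_ * _).
by apply: eq_bigr => i _; rewrite cube_consS.
Qed.

Definition noise_form n tau (f g : cube n -> R) : R :=
  \sum_(x : cube n) \sum_(y : cube n)
    (\prod_i noise_kernel tau (x i) (y i)) * (f x * g y).

(** Induction on n. The kernel being nonnegative, [IHn] bounds the form of each pair of slices, and
    [two_point_bilinear] is applied to the norms of the slices. Two functions are needed even for f
    = g, because the slices at b and c differ. *)
Lemma noise_form_le n r tau (f g : cube n -> R) :
  0 < r -> 0 <= tau <= 1 -> two_point p r tau ->
  noise_form tau f g <= biased_norm p r f * biased_norm p r g.
Proof.
move=> r0 t01 H; elim: n f g => [|n IHn] f g.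
  (* The cube of dimension 0 is one point of mass 1; only here do the signs of f and g enter. *)
  pose x0 : cube 0 := [ffun=> true].
  have E (h : cube 0 -> R) : biased_norm p r h = `|h x0|.
    rewrite /biased_norm /biased_integral (sum_cube0 _ x0) /biased_pmf big_ord0.
    by rewrite mul1r -powRrM mulfV ?gt_eqF// powRr1.
  rewrite /noise_form (sum_cube0 _ x0) (sum_cube0 _ x0) big_ord0 mul1r !E.
  by rewrite -normrM ler_norm.
rewrite !biased_normS//.
apply: le_trans (two_point_bilinear r0 t01 H _ _); last 2 first.
- by move=> b; rewrite powR_ge0.
- by move=> b; rewrite powR_ge0.
rewrite /noise_form sum_cubeS; apply: ler_sum => b _.
under eq_bigr do rewrite sum_cubeS.
rewrite exchange_big/=; apply: ler_sum => c _.
apply: le_trans (ler_wpM2l (noise_kernel_ge0 b c t01) (IHn _ _)).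
rewrite le_eqVlt; apply/orP; left; apply/eqP.
rewrite mulr_sumr; apply: eq_bigr => x _.
rewrite mulr_sumr; apply: eq_bigr => y _.
rewrite [RHS]mulrA big_ord_recl !cube_cons0; congr (noise_kernel tau b c * _ * _).
by apply: eq_bigr => i _; rewrite !cube_consS.
Qed.

(** Expanding the product over the coordinates gives one term s^|S| chi_S(x) chi_S(y) for each set
    [S]. *)
Lemma smoothingE n s (f : cube n -> R) x : smoothing p s f x =
  \sum_(y : cube n) biased_pmf p y * f y *
    \prod_i (1 + s * (char_bit (y i) * char_bit (x i))).
Proof.
rewrite /smoothing.
under eq_bigr do rewrite /fourier_coef /biased_integral mulr_sumr mulr_suml.
rewrite exchange_big/=; apply: eq_bigr => y _.
under [X in _ * X]eq_bigr do rewrite addrC.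
rewrite bigA_distr mulr_sumr; apply: eq_bigr => S _.
rewrite -big_mkcond/= !big_split/= prodr_const /chi /chi1.
rewrite -/(char_bit _); ring.
Qed.

Lemma smoothing_norm2 n s (f : cube n -> R) :
  biased_norm p 2 (smoothing p s f) ^+ 2 = noise_form (s ^+ 2) f f.
Proof.
rewrite -powR_mulrn ?powR_ge0// biased_norm_powR// /biased_integral.
under eq_bigr => x _.
  rewrite powR_mulrn// real_normK ?num_real// expr2 smoothingE mulr_suml mulr_sumr.
  under eq_bigr do rewrite mulr_sumr mulr_sumr.
  over.
rewrite exchange_big/=; apply: eq_bigr => y _.
rewrite exchange_big/=; apply: eq_bigr => z _.
(* For fixed y and z, the sum over x factorises over the coordinates, and [noise_kernel_conv]
   evaluates each factor. *)
transitivity (biased_pmf p y * biased_pmf p z * (f y * f z) *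
  \sum_(x : cube n) \prod_i
   (bernoulli_pmf p (x i) * ((1 + s * (char_bit (y i) * char_bit (x i))) *
      (1 + s * (char_bit (z i) * char_bit (x i)))))).
  rewrite mulr_sumr; apply: eq_bigr => x _.
  by rewrite !big_split/= -/(biased_pmf p x); ring.
rewrite -(bigA_distr_bigA (fun i b => bernoulli_pmf p b *
  ((1 + s * (char_bit (y i) * char_bit b)) *
   (1 + s * (char_bit (z i) * char_bit b))))).
under eq_bigr do rewrite noise_kernel_conv.
rewrite /noise_kernel !big_split/= -!/(biased_pmf p _).
exact: mulrAC.
Qed.

Lemma hypercontractive_of_two_point n r s (f : cube n -> R) :
  0 < r -> s ^+ 2 <= 1 -> two_point p r (s ^+ 2) ->
  biased_norm p 2 (smoothing p s f) <= biased_norm p r f.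
Proof.
move=> r0 s1 H.
have nn q (g : cube n -> R) : biased_norm p q g \in Num.nneg by exact: powR_ge0.
have := noise_form_le f f r0 _ H; rewrite sqr_ge0 s1 => /(_ isT).
by rewrite -smoothing_norm2 -expr2 ler_pXn2r.
Qed.

End Kernel.

(** * The admissible rates *)

Section Rates.
Variable R : realType.
Implicit Types (k x y l r d tau : R).

Lemma expR_convex_le k x : 0 <= k -> k <= 1 ->
  expR (k * x) <= k * expR x + (1 - k).
Proof.
move=> k0 k1; have := convex_expR (Itv01 k0 k1) x 0.
by rewrite !convRE/= !mulr0 addr0 expR0 mulr1.
Qed.

(** Division by exp(k y)/2 turns this into the convexity of exp on the segment between -2y and 0. *)
Lemma sinh_scale_ge k y : 0 <= k -> k <= 1 ->
  k * expR (- ((1 - k) * y)) * sinh y <= sinh (k * y).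
Proof.
move=> k0 k1.
have h := @expR_convex_le k (- (y + y)) k0 k1.
rewrite -(@ler_pM2l _ (2 * expR (- (k * y)))) ?mulr_gt0 ?expR_gt0//.
rewrite [leRHS](_ : _ = 1 - expR (k * - (y + y))); last first.
  rewrite !sinhE (_ : k * - (y + y) = - (k * y) + - (k * y)); last by ring.
  by rewrite expRD expRN; field; rewrite gt_eqF ?expR_gt0.
rewrite [leLHS](_ : _ = k * (1 - expR (- (y + y)))); first by lra.
rewrite !sinhE mulrBl mul1r opprB opprD !expRD !expRN; field.
by rewrite !gt_eqF ?expR_gt0.
Qed.

(* The square of [rho_sinh] times [delta], at [r = 1 + delta ^+ 2]. *)
Definition sinh_ratio l r : R :=
  let L := ln ((1 - l) / l) in sinh ((r - 1) * (L / r)) / sinh (L / r).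

Lemma log_odds_gt0 l : 0 < l -> l < 2^-1 -> 0 < ln ((1 - l) / l).
Proof. by move=> l0 l1; rewrite ln_gt0// ltr_pdivlMr//; lra. Qed.

Lemma sinh_ratio_le l r : 0 < l -> l < 2^-1 -> 1 <= r -> r <= 2 ->
  sinh_ratio l r <= r - 1.
Proof.
move=> l0 l1 r1 r2; have r0 : 0 < r by lra.
have L0 := divr_gt0 (log_odds_gt0 l0 l1) r0.
rewrite /sinh_ratio/= ler_pdivrMr ?sinh_gt0//.
by apply: sinh_scale_le; [lra|lra|exact: ltW].
Qed.

(** Through this bound the rates (i) and (iii) are compared with (ii). It is [sinh_scale_ge] at k =
    r - 1 and y = L/r, where exp(-L) = l/(1 - l). *)
Lemma sinh_ratio_ge l r : 0 < l -> l < 2^-1 -> 1 <= r -> r <= 2 ->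
  (r - 1) * (l / (1 - l)) `^ (2 / r - 1) <= sinh_ratio l r.
Proof.
move=> l0 l1 r1 r2; have r0 : 0 < r by lra.
have L0 := divr_gt0 (log_odds_gt0 l0 l1) r0.
rewrite /sinh_ratio/= ler_pdivlMr ?sinh_gt0//.
have -> : (l / (1 - l)) `^ (2 / r - 1) =
    expR (- ((1 - (r - 1)) * (ln ((1 - l) / l) / r))).
  rewrite /powR gt_eqF; last by rewrite divr_gt0//; lra.
  congr expR; rewrite -[l / _]invf_div lnV ?posrE ?divr_gt0//; last by lra.
  by field; rewrite gt_eqF.
by apply: sinh_scale_ge; lra.
Qed.

Lemma two_point_sinh_ratio l r : 0 < l -> l < 2^-1 -> 1 <= r -> r <= 2 ->
  two_point l r (sinh_ratio l r).
Proof.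
move=> l0 l1 r1 r2; have r0 : 0 < r by lra.
have L0 := log_odds_gt0 l0 l1.
apply: two_point_closure => //; first by lra.
  apply/andP; split; last by apply: le_trans (sinh_ratio_le l0 l1 r1 r2) _; lra.
  apply: le_trans (sinh_ratio_ge l0 l1 r1 r2).
  by rewrite mulr_ge0 ?powR_ge0 ?subr_ge0.
move=> a b a0 b0.
(* This t0 solves exp(2 r t0) = (1 - l)/l. *)
have t0_gt0 : 0 < ln ((1 - l) / l) / (2 * r) by rewrite divr_gt0// mulr_gt0.
have := two_point_sharp_pos r1 r2 t0_gt0 a0 b0; rewrite /=.
set L := ln _.
have <- : l = expR (- (r * (L / (2 * r)))) / (2 * cosh (r * (L / (2 * r)))).
  rewrite (_ : r * (L / (2 * r)) = L / 2); last by field; rewrite gt_eqF.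
  have E : expR (L / 2) * expR (L / 2) = (1 - l) / l.
    rewrite -expRD (_ : L / 2 + L / 2 = L); last by field.
    by rewrite lnK// posrE divr_gt0//; lra.
  have e0 := expR_gt0 (L / 2).
  rewrite !coshE expRN [RHS](_ : _ = (1 + expR (L / 2) * expR (L / 2))^-1).
    by rewrite E; field; rewrite gt_eqF//; lra.
  by field; rewrite !gt_eqF// ?addr_gt0// ?mulr_gt0.
have -> : 2 * ((r - 1) * (L / (2 * r))) = (r - 1) * (L / r).
  by field; rewrite gt_eqF.
have -> : 2 * (L / (2 * r)) = L / r by field; rewrite gt_eqF.
done.
Qed.

(* [sinh_ratio] is the junk value 0 at [l = 1/2], where its limit is [r - 1]. *)
Definition sharp_rate l r : R := if l == 2^-1 then r - 1 else sinh_ratio l r.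

Lemma two_point_sharp_rate l r tau : 0 < l -> l <= 2^-1 -> 1 <= r -> r <= 2 ->
  tau <= sharp_rate l r -> two_point l r tau.
Proof.
move=> l0 l1 r1 r2; rewrite /sharp_rate; case: eqVneq => [->|lN] h.
  apply: (two_point_mono _ _ h); [lra|lra|].
  apply: two_point_closure; [lra|lra|lra|by apply/andP; split; lra|].
  by move=> a b; exact: two_point_sharp_half_pos.
have l2 : l < 2^-1 by rewrite lt_neqAle lN.
by apply: (two_point_mono _ _ h); [lra|lra|exact: two_point_sinh_ratio].
Qed.

Lemma sharp_rate_le1 l r : 0 < l -> l <= 2^-1 -> 1 <= r -> r <= 2 ->
  sharp_rate l r <= 1.
Proof.
move=> l0 l1 r1 r2; rewrite /sharp_rate; case: eqVneq => [_|lN]; first by lra.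
have l2 : l < 2^-1 by rewrite lt_neqAle lN.
by apply: le_trans (sinh_ratio_le l0 l2 r1 r2) _; lra.
Qed.

Lemma sharp_rate_ge l r : 0 < l -> l <= 2^-1 -> 1 <= r -> r <= 2 ->
  (r - 1) * (l / (1 - l)) `^ (2 / r - 1) <= sharp_rate l r.
Proof.
move=> l0 l1 r1 r2; rewrite /sharp_rate; case: eqVneq => [->|lN].
  rewrite (_ : 2^-1 / (1 - 2^-1) = 1 :> R) ?powR1 ?mulr1//.
  by field.
by apply: sinh_ratio_ge => //; rewrite lt_neqAle lN.
Qed.

(** With r = 1 + d^2, the argument q = 1/d^2 + 1 of [rho] is the conjugate exponent of r, so that 1
    - 2/q = 2/r - 1. *)
Lemma admissible_rate_le p rho d (l := bias_min p) : 0 < p -> p < 1 ->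
  admissible_rho p rho -> 0 < d -> d <= 1 ->
  (rho1 rho d * d) ^+ 2 <= sharp_rate l (1 + d ^+ 2).
Proof.
move=> p0 p1 hrho d0 d1.
have l0 : 0 < l by rewrite lt_min p0 subr_gt0.
have l1 : l <= 2^-1 by rewrite ge_min; case: (leP p 2^-1) => //= ?; lra.
have D0 : 0 < d ^+ 2 by rewrite exprn_gt0.
have D1 : d ^+ 2 <= 1 by rewrite expr_le1// ltW.
have dr0 : 0 < 1 + d ^+ 2 by lra.
have q2 : 2 <= 1 / d ^+ 2 + 1 by rewrite -lerBlDr ler_pdivlMr//; lra.
have qV : (1 / d ^+ 2 + 1)^-1 = d ^+ 2 / (1 + d ^+ 2).
  by field; rewrite !gt_eqF// addrC.
have th0 : 0 <= 2 / (1 + d ^+ 2) - 1 by rewrite subr_ge0 ler_pdivlMr//; lra.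
have th1 : 2 / (1 + d ^+ 2) - 1 <= 1 by rewrite lerBlDr ler_pdivrMr//; lra.
have o0 : 0 < l / (1 - l) by rewrite divr_gt0//; lra.
have o1 : l / (1 - l) <= 1 by rewrite ler_pdivrMr//; lra.
have lo : l <= l / (1 - l) by rewrite ler_pdivlMr ?ler_piMr//; lra.
have ext : (l / (1 - l)) `^ (2 / (1 + d ^+ 2) - 1) * d ^+ 2 <=
    sharp_rate l (1 + d ^+ 2).
  have := @sharp_rate_ge l (1 + d ^+ 2) l0 l1.
  by rewrite [1 + _ - 1]addrC addKr mulrC; apply; lra.
rewrite exprMn /rho1; case: hrho => -> //.
(* Rate (i): l <= l/(1 - l), and the exponent 2/r - 1 is nonnegative. *)
- apply: le_trans ext; rewrite ler_wpM2r ?(ltW D0)// /rho_power -/l qV.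
  rewrite -(powR_mulrn 2 (powR_ge0 _ _)) -powRrM.
  rewrite (_ : _ * 2 = 2 / (1 + d ^+ 2) - 1); last by field; rewrite gt_eqF.
  by apply: ge0_ler_powR => //; rewrite nnegrE ltW.
(* Rate (ii): equality holds, since (q - 1) d^2 = 1. *)
- rewrite /rho_sinh -/l /sharp_rate; case: eqVneq => [_|lN].
    by rewrite expr1n mul1r addrC addKr.
  have l2 : l < 2^-1 by rewrite lt_neqAle lN.
  have LE : ln (l / (1 - l)) = - ln ((1 - l) / l).
    by rewrite -invf_div lnV// posrE divr_gt0//; lra.
  rewrite qV LE !mulrNN.
  rewrite (_ : d ^+ 2 / (1 + d ^+ 2) * ln ((1 - l) / l) =
    (1 + d ^+ 2 - 1) * (ln ((1 - l) / l) / (1 + d ^+ 2))); last first.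
    by field; rewrite gt_eqF.
  rewrite (_ : (1 - d ^+ 2 / (1 + d ^+ 2)) * ln ((1 - l) / l) =
    ln ((1 - l) / l) / (1 + d ^+ 2)); last first.
    by field; rewrite gt_eqF.
  rewrite -/(sinh_ratio l (1 + d ^+ 2)) exprMn !sqr_sqrtr.
  + by rewrite le_eqVlt; apply/orP; left; apply/eqP; field; rewrite gt_eqF.
  + apply: le_trans (sinh_ratio_ge l0 l2 _ _); [|lra|lra].
    by rewrite mulr_ge0 ?powR_ge0//; lra.
  + by rewrite addrK divr_ge0// ltW.
(* Rate (iii): a number in ]0, 1] is at most its power with exponent 2/r - 1 <= 1. *)
- apply: le_trans ext; rewrite ler_wpM2r ?(ltW D0)// /rho_const -/l.
  by rewrite sqr_sqrtr ?(ltW o0)// ger1_powR// o0.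
Qed.

End Rates.

Theorem corollary3 (R : realType) (n : nat) (p : R) (hp0 : 0 < p) (hp1 : p < 1)
    (f : cube n -> R) (rho : R -> R) (hrho : admissible_rho p rho)
    (delta : R) (hd0 : 0 <= delta) (hd1 : delta <= 1) :
  biased_norm p 2 (smoothing p (smoothing_rate rho delta) f)
    <= biased_norm p (1 + delta ^+ 2) f.
Proof.
rewrite /smoothing_rate; case: eqVneq => [->|d_neq0].
  (* At delta = 0 the exponent r is 1 and T_0 f is the mean of f. *)
  apply: hypercontractive_of_two_point => //; rewrite expr0n/= ?addr0//.
  by apply: two_point_r1; exact: ltW.
have d0 : 0 < delta by rewrite lt_neqAle eq_sym d_neq0.
have D0 : 0 < delta ^+ 2 by rewrite exprn_gt0.
have D1 : delta ^+ 2 <= 1 by rewrite expr_le1.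
have l0 : 0 < bias_min p by rewrite lt_min hp0 subr_gt0.
have l1 : bias_min p <= 2^-1 by rewrite ge_min; case: (leP p 2^-1) => //= ?; lra.
have h := admissible_rate_le hp0 hp1 hrho d0 hd1.
apply: hypercontractive_of_two_point => //; first by lra.
  by apply: le_trans h (sharp_rate_le1 l0 l1 _ _); lra.
have H := two_point_sharp_rate l0 l1 _ _ h.
(* [H] has parameter min(p, 1 - p); when this is 1 - p, exchanging the two values of the coordinate
   gives the case of p. *)
move: H; rewrite /bias_min /Order.min; case: ifP => _ H.
  by apply: H; lra.
by apply: two_point_sym; apply: H; lra.
Qed.
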